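(* Let $(R,M,k)$ be a finite local ring. Then the sequence of Abelian groups $$1\rightarrow 1+M\rightarrow R^{\ast}\rightarrow k^{\ast}\rightarrow 1,$$ whose maps are the inclusion and the map induced by the natural ring map $R\rightarrow k$, is split-exact. In particular, there is an isomorphism of groups $R^{\ast}\simeq(1+M)\times k^{\ast}$.
   Context: All rings are commutative with $1$. A local ring $(R,M,k)$ is a ring $R$ with a unique maximal ideal $M$ and residue field $k=R/M$; it is finite if $R$ is a finite set. $R^{\ast}$ denotes the multiplicative group of units of $R$, and $1+M=\{1+x: x\in M\}$ is regarded as a subgroup of $R^{\ast}$. The sequence is split-exact if it is exact and there is a group homomorphism $s:k^{\ast}\rightarrow R^{\ast}$ whose composition with $R^{\ast}\rightarrow k^{\ast}$ is the identity. *)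

(* Defs.v *)
From HB Require Import structures.
From mathcomp Require Import all_boot all_order all_algebra all_fingroup.

Set Implicit Arguments.
Unset Strict Implicit.
Unset Printing Implicit Defensive.

Import GRing.Theory.

Local Open Scope ring_scope.
Local Open Scope quotient_scope.

(* The ideals [idealr R] of ring_quotient are proper by definition, so that   *)
(* maximality amounts to maximality among all of them. Ideals are boolean     *)
(* predicates, so equality of ideals is the extensional [=i].                 *)
Definition maximal_ideal (R : comNzRingType) (M : idealr R) : Prop :=
  forall J : idealr R, {subset M <= J} -> J =i M.

Definition local_ring (R : comNzRingType) (M : idealr R) : Prop :=
  maximal_ideal M /\ (forall J : idealr R, maximal_ideal J -> J =i M).

Section ResidueField.

Variables (R : finComNzRingType) (M : idealr R).

(* The proof argument is what allows the field structure to be inferred. *)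
Definition residue_field (locM : local_ring M) : Type := {ideal_quot M}.

Hypothesis locM : local_ring M.

Local Notation k := (residue_field locM).

HB.instance Definition _ := GRing.ComNzRing.on k.

Fact residue_reprK :
  cancel (fun y : k => generic_quotient.repr (y : {ideal_quot M}))
         (fun x : R => \pi_{ideal_quot M} x : k).
Proof. exact: (@reprK R {ideal_quot M}). Qed.

HB.instance Definition _ : isCountable k := CanIsCountable residue_reprK.
HB.instance Definition _ : isFinite k := CanIsFinite residue_reprK.

Definition residue_map (x : R) : k := \pi_{ideal_quot M} x.

Fact residue_map_zmod_morphism : zmod_morphism residue_map.
Proof. exact: (rmorphB (\pi_{ideal_quot M})). Qed.

Fact residue_map_monoid_morphism : monoid_morphism residue_map.
Proof.
by split; [exact: (rmorph1 (\pi_{ideal_quot M}))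
          | exact: (rmorphM (\pi_{ideal_quot M}))].
Qed.

HB.instance Definition _ :=
  GRing.isZmodMorphism.Build R k residue_map residue_map_zmod_morphism.
HB.instance Definition _ :=
  GRing.isMonoidMorphism.Build R k residue_map residue_map_monoid_morphism.

Lemma residue_map_eq0 x : (residue_map x == 0) = (x \in M).
Proof. by rewrite -[0](rmorph0 residue_map) -Quotient.idealrBE subr0. Qed.

Lemma residue_map_surj (y : k) : exists x, residue_map x = y.
Proof. by eexists; exact: residue_reprK. Qed.

(* The ideal generated by M and x. *)
Definition add_principal (x : R) : pred R :=
  fun z => [exists a, z - a * x \in M].

Fact add_principalP (x z : R) :
  reflect (exists a, z - a * x \in M) (z \in add_principal x).
Proof. exact: existsP. Qed.

Fact maximal_ideal_inv (x : R) : x \notin M -> exists a, 1 - a * x \in M.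
Proof.
move=> xM; apply/add_principalP; apply: contraR xM => n1.
have idJ : idealr_closed (add_principal x).
  split=> // [|a u v /add_principalP[b bP] /add_principalP[c cP]];
    apply/add_principalP.
    by exists 0; rewrite mul0r subrr rpred0.
  exists (a * b + c).
  rewrite mulrDl opprD addrACA -mulrA -mulrBr.
  by rewrite rpredD // idealMr.
pose J : idealr R := HB.pack (add_principal x) (isIdealr.Build R _ idJ).
have MJ : {subset M <= J}.
  by move=> z zM; apply/add_principalP; exists 0; rewrite mul0r subr0.
rewrite -(locM.1 J MJ); apply/add_principalP.
by exists 1; rewrite mul1r subrr rpred0.
Qed.

Definition residue_inv (x : k) : k := odflt 0 [pick y | y * x == 1].

Fact residue_mulVf (x : k) : x != 0 -> residue_inv x * x = 1.
Proof.
have [z <-] := residue_map_surj x; rewrite residue_map_eq0 /residue_inv => zM.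
case: pickP => [y /eqP //|no_inv].
have [a] := maximal_ideal_inv zM.
rewrite -residue_map_eq0 rmorphB rmorph1 rmorphM subr_eq0 eq_sym.
by rewrite no_inv.
Qed.

Fact residue_inv0 : residue_inv 0 = 0.
Proof.
rewrite /residue_inv; case: pickP => // y.
by rewrite mulr0 eq_sym oner_eq0.
Qed.

HB.instance Definition _ :=
  GRing.ComNzRing_isField.Build k residue_mulVf residue_inv0.
HB.instance Definition _ := FinRing.isField.Build k.

End ResidueField.

Section MaximalIdeal.

Variable R : finComNzRingType.

Definition is_ideal (A : {set R}) : bool :=
  [&& 0 \in A, 1 \notin A &
      [forall a, forall u in A, forall v in A, a * u + v \in A]].

Fact is_idealP (A : {set R}) : reflect (idealr_closed A) (is_ideal A).
Proof.
apply: (iffP and3P) => -[A0 A1 AP]; split=> //.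
  move=> a u v uA vA.
  by move/forallP/(_ a)/forall_inP/(_ u uA)/forall_inP/(_ v vA): AP.
apply/forallP=> a; apply/forall_inP=> u uA; apply/forall_inP=> v vA.
exact: AP.
Qed.

Lemma sub_maximal_ideal (I : pred R) : idealr_closed I ->
  exists J : idealr R, maximal_ideal J /\ {subset I <= J}.
Proof.
move=> idI; pose P (A : {set R}) := is_ideal A && ([set x in I] \subset A).
have P0 : P [set x in I].
  rewrite /P subxx andbT; apply/is_idealP; case: idI => I0 I1 IP.
  by split=> [||a u v]; rewrite !inE //; apply: IP.
case: (arg_maxnP (fun A : {set R} => #|A|) P0) =>
  A /andP[/is_idealP idA IA] maxA.
pose J : idealr R := HB.pack (fun x => x \in A) (isIdealr.Build R _ idA).
exists J; split=> [J' sJJ'|x xI]; last first.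
  by apply: (subsetP IA); rewrite inE.
have AJ' : A \subset [set x in J'].
  by apply/subsetP=> x xA; rewrite inE; apply: sJJ'.
have PJ' : P [set x in J'].
  rewrite /P (subset_trans IA AJ') andbT; apply/is_idealP; split.
  - by rewrite inE rpred0.
  - by rewrite inE idealr1.
  - by move=> a u v; rewrite !inE => uJ vJ; rewrite rpredD // idealMr.
have /eqP AE : A == [set x in J'] by rewrite eqEcard AJ'; apply: maxA.
by move=> x; rewrite [RHS](_ : _ = (x \in A)) // AE inE.
Qed.

End MaximalIdeal.

Section UnitMap.

Variables (R S : finUnitRingType) (f : {rmorphism R -> S}).

Definition unit_map (u : {unit R}) : {unit S} :=
  FinRing.unit S (rmorph_unit f (valP u)).

Fact unit_map_morphM :
  {in [set: {unit R}] &, {morph unit_map : u v / (u * v)%g}}.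
Proof. by move=> u v _ _; apply: val_inj; rewrite /= rmorphM. Qed.

Canonical unit_map_morphism := Morphism unit_map_morphM.

End UnitMap.

Section OnePlus.

Variables (R : finComUnitRingType) (M : idealr R).

Lemma unit_abelian : abelian [set: {unit R}].
Proof.
by apply/centsP => u _ v _; apply: val_inj; rewrite /= mulrC.
Qed.

Definition one_plus : {set {unit R}} :=
  [set u | FinRing.uval u \in [set 1 + x | x in M]].

Fact one_plus_group_set : group_set one_plus.
Proof.
apply/group_setP; split=> [|u v].
  by rewrite inE; apply/imsetP; exists 0; rewrite ?addr0 ?rpred0.
rewrite !inE /= => /imsetP[x xM ->] /imsetP[y yM ->].
apply/imsetP; exists ((1 + x) * y + x).
  by rewrite rpredD // idealMr.
by rewrite mulrDr mulr1 -addrA [x + _]addrC.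
Qed.

Canonical one_plus_group := Group one_plus_group_set.

(* No element of 1 + M is lost by passing to units. *)
Lemma one_plus_unit (locM : local_ring M) (x : R) :
  x \in M -> 1 + x \is a GRing.unit.
Proof.
move=> xM; apply: contraT => nU.
pose I : pred R := fun z => [exists a, z == a * (1 + x)].
have idI : idealr_closed I.
  split.
  - by apply/existsP; exists 0; rewrite mul0r.
  - apply/existsP=> -[a /eqP a1]; case/negP: nU.
    by apply/unitrP; exists a; split; rewrite ?[(1 + x) * a]mulrC.
  - move=> a u v /existsP[b /eqP ->] /existsP[c /eqP ->].
    by apply/existsP; exists (a * b + c); rewrite mulrDl mulrA.
have [J [maxJ IJ]] := sub_maximal_ideal idI.
have x1J : 1 + x \in J by apply: IJ; apply/existsP; exists 1; rewrite mul1r.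
have xJ : x \in J by rewrite (locM.2 J maxJ).
by rewrite -(idealr1 J) -[1](addrK x) rpredB.
Qed.

Lemma val_one_plus (locM : local_ring M) :
  [set FinRing.uval u | u in one_plus] = [set 1 + x | x in M].
Proof.
apply/setP=> y; apply/imsetP/idP => [[u]|]; first by rewrite inE => uM ->.
move=> yM; have [x xM yE] := imsetP yM.
have uy : y \is a GRing.unit by rewrite yE one_plus_unit.
by exists (FinRing.unit R uy); rewrite ?inE.
Qed.

End OnePlus.

Section SplitExact.

Variables (aT bT cT : finGroupType).
Variables (A : {group aT}) (B : {group bT}) (C : {group cT}).

(* Exactness of 1 -> A -> B -> C -> 1. *)
Definition short_exact (f : {morphism A >-> bT}) (g : {morphism B >-> cT}) :=
  [/\ 'injm f, f @* A = 'ker g & g @* B = C]%g.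

Definition split_exact (f : {morphism A >-> bT}) (g : {morphism B >-> cT}) :=
  short_exact f g /\
  exists s : {morphism C >-> bT},
    (s @* C \subset B)%g /\ {in C, forall x, g (s x) = x}.

End SplitExact.

(* Main.v *)
Require Import Defs.
From mathcomp Require Import all_boot all_order all_algebra all_fingroup.
From mathcomp Require Import cyclic pgroup finfield.

(** The sequence is exact because a unit of R is the same thing as an element
    outside M: modulo M such an element has an inverse, which is an inverse up
    to a factor in 1 + M, and 1 + M consists of units.

    It splits because 1 + M and k^* have coprime orders, so that the projection
    of R^* onto its part prime to #|1 + M| is a power map, and it descends to
    k^*.  For the coprimality, suppose that a prime p divides both orders.  As
    p divides #|k| - 1, it is nonzero in k, so p is not in M
    ([natr_neq0_dvd_units]).  But 1 + M has no n-torsion as soon as n is not in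
    M: if (1 + x)^n = 1 then x * (1 + u + ... + u^(n-1)) = 0 where u = 1 + x,
    and the second factor is congruent to n modulo M, hence a unit
    ([one_plus_torsion_free]).  This contradicts Cauchy's theorem.

    The isomorphism with the product holds for every split short exact sequence
    whose middle group is abelian ([split_exact_isog]). *)

Set Implicit Arguments.
Unset Strict Implicit.
Unset Printing Implicit Defensive.

Import GRing.Theory.

Local Open Scope ring_scope.

Section AbelianExtensions.

Local Open Scope group_scope.

Variables (aT bT cT : finGroupType).
Variables (A : {group aT}) (B : {group bT}) (C : {group cT}).
Variables (f : {morphism A >-> bT}) (g : {morphism B >-> cT}).
Hypothesis abB : abelian B.

(** The section sends x to b ^+ e, where b is any lift of x, with e = 0 modulo
    #|A| and e = 1 modulo #|C|.  The first congruence makes b ^+ e independent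
    of the lift, as lifts differ by an element of f @* A; the second makes it
    a lift of x again. *)
Lemma coprime_short_exact_split :
  short_exact C f g -> coprime #|A| #|C| -> split_exact C f g.
Proof.
move=> exfg coAC; split=> //; have [injf imf img] := exfg.
pose e := chinese #|A| #|C| 0 1.
have kill a : a \in 'ker g -> a ^+ e = 1.
  rewrite -imf => /morphimP[x _ xA ->].
  rewrite -morphX // -(expg_mod _ (expg_cardG xA)) chinese_modl // mod0n.
  by rewrite expg0 morph1.
have fixC x : x \in C -> x ^+ e = x.
  move=> xC; have xn := expg_cardG xC.
  by rewrite -(expg_mod _ xn) chinese_modr // expg_mod.
(* The default 1 is never taken on C, as g is onto. *)
pose lift x := odflt 1 [pick b in B | g b == x].
have liftP x : x \in C -> lift x \in B /\ g (lift x) = x.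
  rewrite /lift; case: pickP => [b /andP[bB /eqP bx] _ // | no_b].
  rewrite -img => /morphimP[b _ bB xE].
  by have := no_b b; rewrite bB xE eqxx.
have liftM : {in C &, {morph (fun x => lift x ^+ e) : x y / x * y}}.
  move=> x y xC yC; have [xB gx] := liftP _ xC; have [yB gy] := liftP _ yC.
  have [xyB gxy] := liftP _ (groupM xC yC).
  rewrite -expgMn; last exact: (centsP abB).
  apply/eqP; rewrite eq_mulgV1 -expgVn -expgMn; last first.
    by apply: (centsP abB); rewrite ?groupV ?groupM.
  apply/eqP/kill/kerP; first by rewrite !(groupM, groupV).
  by rewrite !(morphM, morphV) ?(groupM, groupV) // gxy gx gy mulgV.
exists (Morphism liftM); split.
  apply/subsetP=> _ /morphimP[x _ xC ->] /=.
  by rewrite groupX //; case: (liftP _ xC).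
by move=> x xC /=; have [xB gx] := liftP _ xC; rewrite morphX // gx fixC.
Qed.

(** A section s makes B the internal direct product of f @* A and s @* C. *)
Lemma split_exact_isog : split_exact C f g -> B \isog setX A C.
Proof.
move=> [[injf imf img] [s [sB sK]]].
have fB : f @* A \subset B by rewrite imf subsetIl.
have injs : 'injm s.
  by apply/injmP=> x y xC yC /(congr1 g); rewrite !sK.
have tiB : f @* A :&: s @* C = 1.
  apply/trivgP/subsetP=> b /setIP[] /=; rewrite imf => /mker gb1.
  case/morphimP=> x _ xC bE; move: gb1; rewrite bE sK // => ->.
  by rewrite morph1 inE.
have defB : f @* A \x s @* C = B.
  rewrite (dprodE (sub_abelian_cent2 abB sB fB) tiB).
  apply/eqP; rewrite eqEsubset mul_subG //=; apply/subsetP=> b bB.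
  have gbC : g b \in C by rewrite -img mem_morphim.
  have sgB : s (g b) \in B by apply: (subsetP sB); rewrite mem_morphim.
  rewrite -[b](mulgKV (s (g b))) mem_mulg ?mem_morphim //.
  rewrite imf; apply/kerP; first by rewrite groupM ?groupV.
  by rewrite morphM ?groupV // morphV // sK // mulgV.
apply: isog_dprod defB (setX_dprod A C) _ _.
  by apply: (@isog_trans _ _ _ _ A (setX_group A 1));
    rewrite ?isog_setX1 // isog_sym sub_isog.
by apply: (@isog_trans _ _ _ _ C (setX_group 1 C));
  rewrite ?isog_set1X // isog_sym sub_isog.
Qed.

End AbelianExtensions.

(** If n were zero in F, so would be its multiple #|F| - 1; but #|F| is zero in
    F as the order of the additive group, whence 1 = 0. *)
Lemma natr_neq0_dvd_units (F : finFieldType) (n : nat) :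
  (n %| #|[set: {unit F}]|)%N -> n%:R != 0 :> F.
Proof.
rewrite card_finField_unit => /dvdnP[m mE]; apply/eqP=> n0.
have : #|F|%:R = 0 :> F.
  by rewrite -FinRing.zmodXgE -cardsT expg_cardG ?inE.
rewrite -(ltn_predK (finNzRing_gt1 F)) mE -natr1 natrM n0 mulr0 add0r.
by move/eqP; rewrite oner_eq0.
Qed.

Section LocalRing.

Variables (R : finComUnitRingType) (M : idealr R).
Hypothesis locM : local_ring M.

(** Maximality of M gives a with a * x in 1 + M; this factor is a unit by
    locality. *)
Lemma unit_residue_neq0 (x : R) :
  residue_map locM x != 0 -> x \is a GRing.unit.
Proof.
rewrite residue_map_eq0 => /(maximal_ideal_inv locM)[a axM].
have : a * x \is a GRing.unit.
  have -> : a * x = 1 + - (1 - a * x) by rewrite opprB addrC subrK.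
  by rewrite (one_plus_unit locM) ?rpredN.
by rewrite unitrM => /andP[].
Qed.

Lemma mem_one_plus (u : {unit R}) :
  (u \in one_plus M) = (residue_map locM (FinRing.uval u) == 1).
Proof.
rewrite -subr_eq0 -(rmorph1 (residue_map locM)) -rmorphB residue_map_eq0 inE /=.
apply/imsetP/idP => [[x xM ->] | uM]; first by rewrite addrC addKr.
by exists (FinRing.uval u - 1); rewrite // addrC subrK.
Qed.

(** Factor u ^+ n - 1 by u - 1: the cofactor is a sum of n powers of u, which
    has residue n%:R, hence is a unit. *)
Lemma one_plus_torsion_free (n : nat) (u : {unit R}) :
  n%:R \notin M -> u \in one_plus M -> (u ^+ n)%g = 1%g -> u = 1%g.
Proof.
move=> nM; rewrite mem_one_plus => /eqP u1 un1; apply: val_inj; apply/eqP.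
rewrite /= -subr_eq0; apply/eqP.
have sU : \sum_(i < n) FinRing.uval u ^+ i \is a GRing.unit.
  apply: unit_residue_neq0; rewrite rmorph_sum /=.
  under eq_bigr do rewrite rmorphXn /= u1 expr1n.
  rewrite sumr_const card_ord -(rmorph_nat (residue_map locM)).
  by rewrite residue_map_eq0.
by apply: (mulIr sU); rewrite mul0r -subrX1 -FinRing.val_unitX un1 subrr.
Qed.

(** A common prime p of the two orders is nonzero in k, so that the element of
    order p of 1 + M given by Cauchy's theorem cannot exist. *)
Lemma coprime_one_plus_residue_units :
  coprime #|one_plus M| #|[set: {unit residue_field locM}]|.
Proof.
rewrite coprime_has_primes ?cardG_gt0 //; apply/hasPn=> p.
rewrite !mem_primes => /and3P[p_pr _ pk]; apply/negP=> /and3P[_ _ pM].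
have [u uM ou] := Cauchy p_pr pM.
have pNM : p%:R \notin M.
  by rewrite -(residue_map_eq0 locM) rmorph_nat natr_neq0_dvd_units.
have u1 : u = 1%g.
  by apply: one_plus_torsion_free pNM uM _; rewrite -ou expg_order.
by move: p_pr; rewrite -ou u1 order1.
Qed.

Lemma short_exact_units :
  short_exact [set: {unit residue_field locM}]%G
    (idm_morphism (one_plus_group M))
    (unit_map_morphism (residue_map locM)).
Proof.
split; first exact: injm_idm.
- rewrite morphim_idm //; apply/setP=> u; rewrite mem_one_plus.
  by rewrite !inE.
apply/setP=> y; rewrite inE; apply/morphimP.
have [x xy] := residue_map_surj (FinRing.uval y).
have xU : x \is a GRing.unit.
  by apply: unit_residue_neq0; rewrite xy -unitfE; exact: valP y.
by exists (FinRing.unit R xU); rewrite ?inE //; apply: val_inj.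
Qed.

End LocalRing.

Theorem theorem2p6 (R : finComUnitRingType) (M : idealr R)
    (locM : local_ring M) :
  split_exact [set: {unit residue_field locM}]%G
    (idm_morphism (one_plus_group M))
    (unit_map_morphism (residue_map locM))
  /\ [set: {unit R}]
       \isog setX (one_plus M) [set: {unit residue_field locM}].
Proof.
have spl := coprime_short_exact_split (unit_abelian R)
  (short_exact_units locM) (coprime_one_plus_residue_units locM).
by split=> //; apply: split_exact_isog (unit_abelian R) spl.
Qed.
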